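(* Let $K$ be a field, let $M$ be an abelian monoid with an action of $\operatorname{Inc}(\mathbb N)$ by monoid homomorphisms, let $R=KM$ be the monoid algebra with the induced action, and let $\leq$ be an $\operatorname{Inc}(\mathbb N)$-respecting monomial order on $R$. Assume that $R$ has the finite width property, that $R$ satisfies the finite S-pair condition (for $\Pi=\operatorname{Inc}(\mathbb N)$), and that each truncation $R_n$ is a Noetherian ring. Let $F\subseteq R$ be a finite set and $I=\langle F\rangle_{\operatorname{Inc}(\mathbb N)}$, and assume that $I$ has a finite $\operatorname{Inc}(\mathbb N)$-equivariant Gröbner basis with respect to $\leq$. Then the procedure TruncatedEGB, run on input $F$, terminates after finitely many steps, and its output $G$ is a finite $\operatorname{Inc}(\mathbb N)$-equivariant Gröbner basis of $I$. Here TruncatedEGB is the following procedure: set $G:=F$ and $n:=w(F)$; while $G$ is not an $\operatorname{Inc}(\mathbb N)$-equivariant Gröbner basis of $I$, replace $G$ by a finite Gröbner basis of the ideal $\tilde I_{F,n}$ of $R_n$ and then replace $n$ by $n+1$; when the loop ends, return $G$.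
   Context: $\mathbb N=\{1,2,3,\dots\}$, $[n]=\{1,\dots,n\}$; $\operatorname{Inc}(\mathbb N)$ is the monoid of strictly increasing functions $\mathbb N\to\mathbb N$. Elements of $M$ are called monomials of $R=KM$. Width: for $f\in R$, $w(f)$ is the smallest integer $n\ge 0$ such that every $\sigma\in\operatorname{Inc}(\mathbb N)$ fixing each of $1,\dots,n$ fixes $f$ ($\infty$ if none exists); for a set $F$, $w(F)=\sup_{f\in F}w(f)$. $R$ has the finite width property if all $w(f)$ are finite. The truncation is $R_n=\{f\in R\mid w(f)\leq n\}$. A monomial order on $R=KM$ is a total well-order $\leq$ on $M$ such that $a<b$ implies $ac<bc$ for all $c\in M$; it is $\operatorname{Inc}(\mathbb N)$-respecting if $a<b$ implies $\sigma a<\sigma b$ for all $\sigma\in\operatorname{Inc}(\mathbb N)$. $\operatorname{in}_\leq f$ is the initial (largest) monomial of $f\neq0$, and $\operatorname{in}_\leq I$ is the ideal generated by initial monomials of nonzero elements of $I$. A Gröbner basis of an ideal $J$ of $R_n$ is a subset of $J$ whose initial monomials generate (in $R_n$) the ideal generated by the initial monomials of all nonzero elements of $J$. $\langle F\rangle_{\operatorname{Inc}(\mathbb N)}$ is the ideal of $R$ generated by $\operatorname{Inc}(\mathbb N)F=\{\sigma f\mid\sigma\in\operatorname{Inc}(\mathbb N),f\in F\}$. A set $G\subseteq I$ is an $\operatorname{Inc}(\mathbb N)$-equivariant Gröbner basis of the $\operatorname{Inc}(\mathbb N)$-invariant ideal $I$ if $\langle\operatorname{in}_\leq(\operatorname{Inc}(\mathbb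 N)G)\rangle=\operatorname{in}_\leq I$. Generator truncation: $\tilde I_{F,n}=\langle \operatorname{Inc}(\mathbb N)F\cap R_n\rangle\cap R_n$, where $\langle\cdot\rangle$ is the ideal generated in $R$. Finite S-pair condition: let $M*\operatorname{Inc}(\mathbb N)$ be the monoid of pairs $(m,\sigma)\in M\times\operatorname{Inc}(\mathbb N)$ with $(m,\sigma)(n,\tau)=(m\,\sigma(n),\sigma\tau)$, acting on $R$ by $(m,\sigma)f=m\,\sigma(f)$. For nonzero $f,g\in R$ let $\mathcal S_{f,g}=\{(m_1f,m_2g)\mid m_1,m_2\in M*\operatorname{Inc}(\mathbb N),\ \operatorname{in}_\leq(m_1f)=\operatorname{in}_\leq(m_2g)\}$, which is closed under the diagonal action of $M*\operatorname{Inc}(\mathbb N)$. The condition says that for all nonzero $f,g\in R$, $\mathcal S_{f,g}$ is finitely generated as an $M*\operatorname{Inc}(\mathbb N)$-set, i.e. there is a finite subset $O\subseteq \mathcal S_{f,g}$ such that every element of $\mathcal S_{f,g}$ is of the form $(m h_1,m h_2)$ with $m\in M*\operatorname{Inc}(\mathbb N)$, $(h_1,h_2)\in O$. *)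

(* Defs.v *)
From mathcomp Require Import all_boot all_order all_algebra.
From mathcomp Require Import finmap.
From mathcomp.classical Require Import boolp classical_sets cardinality wochoice.
From mathcomp.multinomials Require Import monalg.

Set Implicit Arguments.
Unset Strict Implicit.
Unset Printing Implicit Defensive.

Import GRing.Theory.
Local Open Scope classical_set_scope.
Local Open Scope ring_scope.

(** Inc(N), with N = 1, 2, 3, ... shifted to 0, 1, 2, ...: the elements
    1, ..., n of N correspond to the naturals [i < n]. *)
Record inc := Inc {
  inc_fun :> nat -> nat;
  inc_mono : {homo inc_fun : i j / (i < j)%N}
}.

Definition inc_id : inc := @Inc id (fun i j lt_ij => lt_ij).

Definition inc_comp (s t : inc) : inc :=
  @Inc (fun i => s (t i)) (fun i j lt_ij => inc_mono s (inc_mono t lt_ij)).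

(** Actions of the monoid [inc] on a commutative monoid by monoid morphisms. *)
Record inc_action (M : conomType) := IncAction {
  iact :> inc -> M -> M;
  iact_id : forall m, iact inc_id m = m;
  iact_comp : forall s t m, iact (inc_comp s t) m = iact s (iact t m);
  iact_one : forall s, iact s (@mone M) = @mone M;
  iact_mul : forall s m1 m2, iact s (mmul m1 m2) = mmul (iact s m1) (iact s m2)
}.

(** [well_order] is the existence of a unique least element in every nonempty
    subset; the compatibility clause is for the strict order. *)
Record monomial_order (M : conomType) (le : rel M) : Prop := MonomialOrder {
  monomial_total_order : wochoice.total_order le;
  monomial_well_order : wochoice.well_order le;
  monomial_order_mul : forall a b c : M,
    le a b -> a <> b ->
    le (mmul a c) (mmul b c) /\ mmul a c <> mmul b c
}.

Definition inc_respecting (M : conomType) (act : inc_action M) (le : rel M) :=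
  forall (s : inc) (a b : M),
    le a b -> a <> b -> le (act s a) (act s b) /\ act s a <> act s b.

(** A [conomType] is a commutative monoid without nontrivial units.  This is no
    restriction here: it holds in every commutative monoid that carries a
    monomial order. *)
Lemma monomial_order_unitm (T : choiceType) (one : T) (mul : T -> T -> T)
    (le : rel T) :
  associative mul -> commutative mul -> left_id one mul ->
  wochoice.total_order le -> wochoice.well_order le ->
  (forall a b c, le a b -> a <> b ->
     le (mul a c) (mul b c) /\ mul a c <> mul b c) ->
  forall x y, mul x y = one -> x = one /\ y = one.
Proof.
move=> mulA mulC mul1 [[[lexx le_tr] le_anti] le_tot] wo mono.
have ge1 x : le one x.
  have [|z [[_ zmin] _]] := wo predT; first by exists x.
  suff -> : one = z by exact: zmin.
  apply: contrapT => ne1z.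
  have lez1 : le z one by exact: zmin.
  have [le2 ne2] := mono z one z lez1 (fun e => ne1z (esym e)).
  rewrite mul1 in le2 ne2; apply: ne2; apply: le_anti.
  by rewrite le2 /=; exact: zmin.
suff unit1 x y : mul x y = one -> x = one.
  by move=> x y e; split; [exact: unit1 e | apply: (unit1 y x); rewrite mulC].
move=> e; apply: contrapT => nex.
have [le1 ne1] := mono one x y (ge1 x) (fun e' => nex (esym e')).
rewrite mul1 e in le1 ne1; apply: ne1; apply: le_anti.
by rewrite le1 ge1.
Qed.

Section IdealsInSubrings.
Variable R : comNzRingType.
Implicit Types (S J A : set R).

(** Subrings [S] of [R] and their ideals are handled as subsets of [R]. *)
Definition is_ideal S J : Prop :=
  [/\ J `<=` S, J 0,
      forall f g, J f -> J g -> J (f + g) &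
      forall r f, S r -> J f -> J (r * f)].

(** The ideal of [S] generated by [A]; it is only used with [A `<=` S]. *)
Definition ideal_gen S A : set R := smallest (is_ideal S) A.

Definition noetherian S : Prop :=
  forall J, is_ideal S J ->
    exists A, [/\ finite_set A, A `<=` J & J = ideal_gen S A].

End IdealsInSubrings.

Section MonoidAlgebra.
Variables (K : fieldType) (M : conomType).
Variables (act : inc_action M) (le : rel M).
Local Notation R := {malg K[M]}.
Implicit Types (f g : R) (F G I J A : set R) (s : inc) (n : nat).

(** The linear extension of the action to the monoid algebra. *)
Definition ract s f : R := \sum_(m <- msupp f) << f@_m *g act s m >>.

Definition orbit_set F : set R := [set h | exists s, exists2 f, F f & h = ract s f].

(** The least [n] such that [P n], with [None] standing for infinity. *)
Definition least (P : nat -> Prop) : option nat :=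
  if pselect (exists n, `[< P n >]) is left exP then Some (ex_minn exP) else None.

Definition oleq (w : option nat) n : bool := if w is Some k then (k <= n)%N else false.

Definition width f : option nat :=
  least (fun n => forall s, (forall i, (i < n)%N -> s i = i) -> ract s f = f).

(** The supremum, as the least upper bound among the naturals and infinity. *)
Definition width_set F : option nat :=
  least (fun n => forall f, F f -> oleq (width f) n).

Definition finite_width_property : Prop := forall f, width f <> None.

Definition trunc n : set R := [set f | oleq (width f) n].

(** The initial monomial; the value for [f = 0] is irrelevant. *)
Definition initm f : M :=
  xget (@mone M) [set m | m \in msupp f /\ forall m', m' \in msupp f -> le m' m].

Definition init_set A : set R := [set h | exists2 f, A f /\ f <> 0 & h = << initm f >>].

Definition inc_ideal F : set R := ideal_gen setT (orbit_set F).

Definition is_groebner n J G : Prop :=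
  G `<=` J /\
  ideal_gen (trunc n) (init_set G) = ideal_gen (trunc n) (init_set J).

Definition is_egb I G : Prop :=
  G `<=` I /\
  ideal_gen setT (init_set (orbit_set G)) = ideal_gen setT (init_set I).

Definition gen_trunc F n : set R :=
  ideal_gen setT (orbit_set F `&` trunc n) `&` trunc n.

(** The action on [R] of an element [(m, s)] of the monoid [M * Inc(N)]. *)
Definition pact (a : M * inc) f : R := << a.1 >> * ract a.2 f.

Definition spairs f g : set (R * R) :=
  [set p | exists a b : M * inc,
     p = (pact a f, pact b g) /\ initm (pact a f) = initm (pact b g)].

Definition finite_spair_condition : Prop :=
  forall f g, f <> 0 -> g <> 0 ->
    exists O : set (R * R),
      [/\ finite_set O, O `<=` spairs f g &
          forall p, spairs f g p ->
            exists a : M * inc, exists2 h, O h & p = (pact a h.1, pact a h.2)].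

Section TruncatedEGB.
Variable F : set R.

(** The state of the procedure consists of the values of [G] and [n]. *)
Definition egb_halts (st : set R * nat) : Prop := is_egb (inc_ideal F) st.1.

(** One pass through the loop; any finite Groebner basis may be chosen. *)
Definition egb_step (st st' : set R * nat) : Prop :=
  [/\ ~ egb_halts st,
      finite_set st'.1,
      is_groebner st.2 (gen_trunc F st.2) st'.1 &
      st'.2 = st.2.+1].

(** The loop can always be continued until its exit test succeeds, and this
    happens after finitely many passes whatever choices are made. *)
Inductive egb_terminates (st : set R * nat) : Prop :=
| EgbHalt of egb_halts st
| EgbLoop of (exists st', egb_step st st')
    & (forall st', egb_step st st' -> egb_terminates st').

Inductive egb_returns : set R * nat -> set R -> Prop :=
| EgbReturn st : egb_halts st -> egb_returns st st.1
| EgbIter st st' G : egb_step st st' -> egb_returns st' G -> egb_returns st G.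

End TruncatedEGB.

End MonoidAlgebra.

Arguments finite_width_property K {M} act.
Arguments finite_spair_condition K {M} act le.
Arguments trunc K {M} act n.

(* Main.v *)
Require Import Defs.
From HB Require Import structures.
From mathcomp Require Import all_boot all_order all_algebra.
From mathcomp Require Import finmap.
From mathcomp.classical Require Import boolp classical_sets cardinality wochoice.
From mathcomp.multinomials Require Import monalg.

Set Implicit Arguments.
Unset Strict Implicit.
Unset Printing Implicit Defensive.

Import GRing.Theory.
Local Open Scope classical_set_scope.
Local Open Scope ring_scope.

(** Let H be a finite equivariant Groebner basis of I, the Inc(N)-ideal
    generated by F.  Each element of H is a combination of finitely many elements
    of the orbit of F, and all the polynomials involved have finite width; so H
    lies in the generator truncation of I at some N, and then at every n >= N
    ([finite_set_gen_trunc], [gen_trunc_le]).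

    Let G be any Groebner basis of the truncation at such an n.  Since H lies in
    that truncation, the initial monomials of H lie in the ideal generated by
    those of G.  Elements of Inc(N) act as ring endomorphisms that commute with
    taking initial monomials, so the same holds for the orbits of H and of G; but
    the initial monomials of the orbit of H generate the initial ideal of I.
    Hence G is an equivariant Groebner basis ([groebner_gen_trunc_is_egb]), and
    the loop stops at the latest after its first pass with n >= N.

    A pass can always be carried out because the initial monomial of a polynomial
    is at most as wide as the polynomial ([init_set_trunc]).  The initial ideal
    is therefore generated by elements of the Noetherian ring R_n, and finitely
    many initial monomials suffice ([finite_groebner_exists]).  The output is
    correct by the exit test of the loop, once it terminates. *)

(** * Ideals of subrings *)

Section Ideals.
Variable R : comNzRingType.
Implicit Types (S J A B C : set R).

Lemma is_ideal_setT : is_ideal setT (@setT R).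
Proof. by split. Qed.

(** The hypothesis [is_ideal S S] is how closure of [S] under sums and products
    is expressed here.  That [A] lies in [S] matters: otherwise no ideal of [S]
    contains [A], and the intersection defining [ideal_gen S A] is everything. *)
Lemma ideal_gen_is_ideal S A :
  is_ideal S S -> A `<=` S -> is_ideal S (ideal_gen S A).
Proof.
move=> Sid AS; split=> [||f g If Ig|r f Sr If].
- exact: smallest_sub.
- by move=> J [[_ J0 _ _] _].
- by move=> J [/[dup] Jid [_ _ JD _] AJ]; apply: JD; [apply: If | apply: Ig].
- by move=> J [/[dup] Jid [_ _ _ JM] AJ]; apply: JM => //; apply: If.
Qed.

Lemma ideal_gen_setT_is_ideal A : is_ideal setT (ideal_gen setT A).
Proof. by apply: ideal_gen_is_ideal => //; exact: is_ideal_setT. Qed.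

Lemma ideal_gen_le S A B :
  is_ideal S S -> B `<=` S -> A `<=` B -> ideal_gen S A `<=` ideal_gen S B.
Proof.
by move=> Sid BS; apply: sub_smallest2r; exact: ideal_gen_is_ideal.
Qed.

Lemma ideal_setTI_is_ideal S J :
  is_ideal S S -> is_ideal setT J -> is_ideal S (J `&` S).
Proof.
move=> [_ S0 SD SM] [_ J0 JD JM]; split.
- by move=> f [].
- by [].
- by move=> f g [Jf Sf] [Jg Sg]; split; [exact: JD | exact: SD].
- by move=> r f Sr [Jf Sf]; split; [exact: JM | exact: SM].
Qed.

(** The ideal that [A] generates in the whole ring contracts to an ideal of [S]. *)
Lemma ideal_gen_extension S A :
  is_ideal S S -> A `<=` S -> ideal_gen S A `<=` ideal_gen setT A.
Proof.
move=> Sid AS; apply: subset_trans (@subIsetl _ _ S).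
apply: smallest_sub.
  by apply: ideal_setTI_is_ideal => //; exact: ideal_gen_setT_is_ideal.
by move=> f Af; split; [exact: sub_gen_smallest | exact: AS].
Qed.

(** The elements generated by finite subsets of [A] already form an ideal. *)
Lemma ideal_gen_finite_support S A f :
  is_ideal S S -> A `<=` S -> ideal_gen S A f ->
  exists B, [/\ finite_set B, B `<=` A & ideal_gen S B f].
Proof.
move=> Sid AS.
pose J := [set f | exists B, [/\ finite_set B, B `<=` A & ideal_gen S B f]].
suff: ideal_gen S A `<=` J by move=> /[apply].
have genid B : B `<=` A -> is_ideal S (ideal_gen S B).
  by move=> BA; apply: ideal_gen_is_ideal => //; exact: subset_trans AS.
apply: smallest_sub => [|{}f Af]; last first.
  exists [set f]; split; first exact: finite_set1.
    by move=> _ ->.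
  exact: sub_gen_smallest.
split.
- by move=> {}f [B [_ BA]]; have [+ _ _ _] := genid _ BA; exact.
- exists set0; split=> //.
  by have [] := genid set0 (@sub0set _ _).
- move=> {}f g [B [finB BA Bf]] [C [finC CA Cg]].
  have BCA : B `|` C `<=` A by rewrite subUset.
  have BCS := subset_trans BCA AS.
  exists (B `|` C); split=> //; first by rewrite finite_setU.
  have [_ _ JD _] := genid _ BCA.
  apply: JD.
    by apply: ideal_gen_le Bf => //; exact: subsetUl.
  by apply: ideal_gen_le Cg => //; exact: subsetUr.
- move=> r {}f Sr [B [finB BA Bf]]; exists B; split=> //.
  by have [_ _ _ JM] := genid _ BA; exact: JM.
Qed.

Lemma ideal_gen_finite_subset S A C :
  is_ideal S S -> A `<=` S -> finite_set C -> C `<=` ideal_gen S A ->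
  exists B, [/\ finite_set B, B `<=` A & C `<=` ideal_gen S B].
Proof.
move=> Sid AS finC CA.
have /choice[b bP] f : exists B,
    C f -> [/\ finite_set B, B `<=` A & ideal_gen S B f].
  have [Cf|nCf] := pselect (C f); last by exists set0.
  by have [B BP] := ideal_gen_finite_support Sid AS (CA _ Cf); exists B.
exists (\bigcup_(f in C) b f); split.
- by apply: bigcup_finite => // f /bP[].
- by move=> g [f /bP[_ bA _]]; exact: bA.
- move=> f Cf; have [_ _ bf] := bP _ Cf.
  apply: ideal_gen_le bf => //; last by move=> g bg; exists f.
  by move=> g [h /bP[_ bA _]] /bA /AS.
Qed.

(** Noetherianity provides finitely many generators anywhere in the ideal; here
    they are chosen inside a prescribed generating set, so that an initial ideal
    is generated by finitely many initial monomials. *)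
Lemma noetherian_ideal_gen S A :
  is_ideal S S -> noetherian S -> A `<=` S ->
  exists B, [/\ finite_set B, B `<=` A & ideal_gen S B = ideal_gen S A].
Proof.
move=> Sid noeth AS.
have [C [finC CA eqC]] := noeth _ (ideal_gen_is_ideal Sid AS).
have [B [finB BA CB]] := ideal_gen_finite_subset Sid AS finC CA.
exists B; split=> //; apply/seteqP; split; first exact: ideal_gen_le.
rewrite eqC; apply: smallest_sub => //.
by apply: ideal_gen_is_ideal => //; exact: subset_trans AS.
Qed.

End Ideals.

(** * Initial monomials *)

Section InitialMonomial.
Variables (K : fieldType) (M : conomType) (le : rel M).
Hypothesis le_total : wochoice.total_order le.
Local Notation R := {malg K[M]}.
Implicit Types (f : R) (m : M).

Let le_refl : reflexive le. Proof. by case: le_total => [[[]]]. Qed.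
Let le_trans : transitive le. Proof. by case: le_total => [[[]]]. Qed.
Let le_anti : antisymmetric le. Proof. by case: le_total => [[]]. Qed.
Let le_tot : total le. Proof. by case: le_total. Qed.

Lemma initm_unique f m :
  m \in msupp f -> (forall m', m' \in msupp f -> le m' m) -> initm le f = m.
Proof.
move=> fm mmax; apply: xget_unique => // m' [fm' m'max].
by apply: le_anti; rewrite mmax //= m'max.
Qed.

Lemma initmP f : f <> 0 ->
  initm le f \in msupp f /\ forall m, m \in msupp f -> le m (initm le f).
Proof.
move=> f0.
have max_seq (s : seq M) : s != [::] ->
    exists2 m, m \in s & forall m', m' \in s -> le m' m.
  elim: s => // x [|y s] IHs _.
    by exists x; rewrite ?inE // => m'; rewrite inE => /eqP->.
  have [//|m sm mmax] := IHs.
  have [lexm|lemx] := orP (le_tot x m).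
    exists m; first by rewrite inE sm orbT.
    by move=> m'; rewrite inE => /predU1P[->//|/mmax].
  exists x; first by rewrite inE eqxx.
  move=> m'; rewrite inE => /predU1P[->//|/mmax lem'm].
  exact: le_trans lemx.
have [|m fm mmax] := max_seq (msupp f).
  apply/eqP => s0; apply: f0; apply/eqP; rewrite -msupp_eq0.
  by apply/eqP/fsetP => m; rewrite in_fset0 -[LHS]/(m \in enum_fset _) s0.
by rewrite (initm_unique fm mmax).
Qed.

End InitialMonomial.

(** * The action on the monoid algebra *)

Section Action.
Variables (K : fieldType) (M : conomType) (act : inc_action M).
Local Notation R := {malg K[M]}.
Local Notation ract := (@ract K M act).
Local Notation trunc := (@trunc K M act).
Local Notation inc_ideal := (@inc_ideal K M act).
Local Notation orbit_set := (@orbit_set K M act).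
Implicit Types (f g : R) (F G : set R) (m : M) (s t : inc) (n : nat).

(** Through [act_monom s] the map [ract s] is an instance of the evaluation
    morphism [mmap], from which its additivity and multiplicativity follow. *)
Definition act_monom s m : R := << act s m >>.

Lemma act_monom_mmorphism s : mmorphism (act_monom s).
Proof.
split=> [m1 m2|]; rewrite /act_monom ?iact_one // iact_mul.
by rewrite malgM_def fgmulUU mulr1.
Qed.

HB.instance Definition _ s :=
  isMultiplicative.Build M R (act_monom s) (act_monom_mmorphism s).

Lemma ract_mmap s : ract s = mmap malgC (act_monom s).
Proof.
apply/funext => f; apply: eq_bigr => m _.
by rewrite /act_monom malgM_def fgmulUU mulr1 mul1m.
Qed.

Lemma ract0 s : ract s 0 = 0.
Proof. by rewrite ract_mmap raddf0. Qed.

Lemma ractD s f g : ract s (f + g) = ract s f + ract s g.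
Proof. by rewrite ract_mmap raddfD. Qed.

Lemma ractM s f g : ract s (f * g) = ract s f * ract s g.
Proof. by rewrite ract_mmap rmorphM. Qed.

Lemma ract_monom s (c : K) m : ract s << c *g m >> = << c *g act s m >>.
Proof.
by rewrite ract_mmap mmapU /= malgM_def fgmulUU mulr1 mul1m.
Qed.

Lemma ract_comp s t f : ract (inc_comp s t) f = ract s (ract t f).
Proof.
rewrite [ract t f]/Defs.ract (ract_mmap s) raddf_sum.
by apply: eq_bigr => m _ /=; rewrite -ract_mmap ract_monom iact_comp.
Qed.

(** By minimality of generated ideals, it suffices to check on generators that
    [ract s] maps a generated ideal into [J]. *)
Lemma preim_ract_is_ideal s (J : set R) :
  is_ideal setT J -> is_ideal setT [set f | J (ract s f)].
Proof.
move=> [_ J0 JD JM]; split=> //=; first by rewrite ract0.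
  by move=> f g Jf Jg; rewrite ractD; exact: JD.
by move=> r f _ Jf; rewrite ractM; exact: JM.
Qed.

Lemma ract_inc_ideal F s f : inc_ideal F f -> inc_ideal F (ract s f).
Proof.
suff: inc_ideal F `<=` [set g | inc_ideal F (ract s g)] by exact.
apply: smallest_sub.
  by apply: preim_ract_is_ideal; exact: ideal_gen_setT_is_ideal.
move=> _ [t [g Fg ->]]; apply: sub_gen_smallest.
by exists (inc_comp s t), g => //; rewrite ract_comp.
Qed.

Lemma orbit_set_sub_inc_ideal F G :
  G `<=` inc_ideal F -> orbit_set G `<=` inc_ideal F.
Proof. by move=> GF _ [s [g Gg ->]]; apply: ract_inc_ideal; exact: GF. Qed.

(** * Widths and truncations *)

Lemma leastP (P : nat -> Prop) n :
  (forall k l, (k <= l)%N -> P k -> P l) -> oleq (least P) n <-> P n.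
Proof.
move=> P_up; rewrite /least; case: pselect => [exP|nexP] /=.
  case: ex_minnP => k /asboolP Pk kmin; split=> [kn|Pn].
    exact: P_up kn Pk.
  by apply: kmin; apply/asboolP.
by split=> // Pn; case: nexP; exists n; apply/asboolP.
Qed.

Lemma truncP n f :
  trunc n f <-> forall s, (forall i, (i < n)%N -> s i = i) -> ract s f = f.
Proof.
apply: leastP => k l kl kP s sl; apply: kP => i ik.
by apply: sl; exact: leq_trans kl.
Qed.

Lemma trunc_le n n' f : (n <= n')%N -> trunc n f -> trunc n' f.
Proof.
move=> nn' /truncP fP; apply/truncP => s sP; apply: fP => i ni.
by apply: sP; exact: leq_trans nn'.
Qed.

Lemma trunc_is_ideal n : is_ideal (trunc n) (trunc n).
Proof.
split=> //.
- by apply/truncP => s _; rewrite ract0.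
- move=> f g /truncP fP /truncP gP; apply/truncP => s sP.
  by rewrite ractD fP // gP.
- move=> f g /truncP fP /truncP gP; apply/truncP => s sP.
  by rewrite ractM fP // gP.
Qed.

Lemma gen_trunc_sub_inc_ideal F n : gen_trunc act F n `<=` inc_ideal F.
Proof.
by move=> f [+ _]; apply: ideal_gen_le => //; exact: subIsetl.
Qed.

Lemma gen_trunc_le F n n' :
  (n <= n')%N -> gen_trunc act F n `<=` gen_trunc act F n'.
Proof.
move=> nn' f [If tf]; split; last exact: trunc_le tf.
apply: ideal_gen_le If => //.
by move=> g [Fg tg]; split=> //; exact: trunc_le tg.
Qed.

Section FiniteWidth.
Hypothesis finite_width : finite_width_property K act.

Lemma finite_width_trunc f : exists n, trunc n f.
Proof.
rewrite /trunc /Defs.trunc /=.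
by case: width (@finite_width f) => // k _; exists k => /=.
Qed.

Lemma finite_set_trunc G : finite_set G -> exists n, G `<=` trunc n.
Proof.
move=> /finite_seqP[r ->]; elim: r => [|f r [n IHn]]; first by exists 0%N.
have [k fk] := finite_width_trunc f.
exists (maxn n k) => g /=; rewrite inE => /predU1P[->|/IHn].
  by apply: trunc_le fk; rewrite leq_maxr.
by apply: trunc_le; rewrite leq_maxl.
Qed.

Lemma width_set_finite G : finite_set G -> exists n, width_set act G = Some n.
Proof.
move=> /finite_set_trunc[k Gk].
suff: oleq (width_set act G) k by case: width_set => // n _; exists n.
apply/leastP => // l l' ll' Gl f Gf.
exact: (trunc_le ll' (Gl f Gf)).
Qed.

Lemma finite_set_gen_trunc F G :
  finite_set G -> G `<=` inc_ideal F ->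
  exists n, G `<=` gen_trunc act F n.
Proof.
move=> finG GF.
have [B [finB BF GB]] :=
  ideal_gen_finite_subset (is_ideal_setT R) (@subsetT _ _) finG GF.
have [n] : exists n, G `|` B `<=` trunc n.
  by apply: finite_set_trunc; rewrite finite_setU.
rewrite subUset => -[Gn Bn]; exists n => g Gg; split; last exact: Gn.
apply: ideal_gen_le (GB _ Gg) => //.
by move=> f Bf; split; [exact: BF | exact: Bn].
Qed.

End FiniteWidth.

(** * Initial ideals and Groebner bases *)

Section Order.
Variable le : rel M.
Hypotheses (le_monomial : monomial_order le)
  (le_respecting : inc_respecting act le).
Local Notation initm := (@initm K M le).
Local Notation init_set := (@init_set K M le).

Let le_total : wochoice.total_order le := monomial_total_order le_monomial.

(** Two distinct monomials are comparable, and a respecting order keeps them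
    distinct. *)
Lemma act_inj s : injective (act s).
Proof.
move=> a b eqab; apply: contrapT => neab.
have [_ le_tot] := le_total.
have [/le_respecting/(_ neab)|/le_respecting/(_ (nesym neab))] :=
  orP (le_tot a b) => /(_ s)[_]; by rewrite eqab.
Qed.

Lemma act_le s a b : le a b -> le (act s a) (act s b).
Proof.
have [->|neab] := pselect (a = b); last by case/(le_respecting s).
by move=> _; have [[[lexx _] _] _] := le_total; exact: lexx.
Qed.

Lemma mcoeff_ract s f m : (ract s f)@_(act s m) = f@_m.
Proof.
rewrite [in RHS](monalgE f) /Defs.ract !raddf_sum; apply: eq_bigr => k _ /=.
by rewrite !mcoeffU (inj_eq (@act_inj s)).
Qed.

Lemma msupp_ract s f m :
  m \in msupp (ract s f) -> exists2 k, k \in msupp f & m = act s k.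
Proof.
rewrite -mcoeff_neq0 /Defs.ract raddf_sum => /eqP sum_neq0.
apply: contrapT => nex; apply: sum_neq0.
rewrite big_seq big1 // => k fk /=; rewrite mcoeffU.
by case: eqP => // eqm; case: nex; exists k.
Qed.

Lemma ract_neq0 s f : f <> 0 -> ract s f <> 0.
Proof.
move=> f0 sf0; apply: f0; apply/malgP => m.
by rewrite -(mcoeff_ract s) sf0 !mcoeff0.
Qed.

Lemma initm_ract s f : f <> 0 -> initm (ract s f) = act s (initm f).
Proof.
move=> /(initmP le_total)[fm fmax]; apply: initm_unique => //.
  by rewrite -mcoeff_neq0 mcoeff_ract mcoeff_neq0.
by move=> _ /msupp_ract[k fk ->]; apply/act_le/fmax.
Qed.

(** If [ract s] fixes [f], then it fixes the initial monomial of [f], because the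
    initial monomial commutes with the action. *)
Lemma init_set_trunc n F : F `<=` trunc n -> init_set F `<=` trunc n.
Proof.
move=> Fn _ [f [/Fn/truncP fP f0] ->]; apply/truncP => s sP.
by rewrite ract_monom -initm_ract // fP.
Qed.

Lemma init_setS F G : F `<=` G -> init_set F `<=` init_set G.
Proof. by move=> FG _ [f [/FG Gf f0] ->]; exists f. Qed.

(** Finitely many initial monomials generate the initial ideal of [J]; a Groebner
    basis consists of one element of [J] above each of them. *)
Lemma finite_groebner_exists n (J : set R) :
  noetherian (trunc n) -> J `<=` trunc n ->
  exists G, finite_set G /\ is_groebner act le n J G.
Proof.
move=> noeth Jn.
have Sid := trunc_is_ideal n; have initJn := init_set_trunc Jn.
have [B [finB BJ eqB]] := noetherian_ideal_gen Sid noeth initJn.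
have /choice[lift liftP] h : exists f,
    B h -> [/\ J f, f <> 0 & h = << initm f >>].
  have [/BJ[f [Jf f0] ->]|nBh] := pselect (B h); last by exists 0.
  by exists f.
have GJ : lift @` B `<=` J by move=> _ [h /liftP[Jf _ _] <-].
exists (lift @` B); split; first exact: finite_image.
split=> //; apply/seteqP; split.
  by apply: ideal_gen_le => //; exact: init_setS.
rewrite -eqB; apply: ideal_gen_le => //.
  by apply: subset_trans initJn; exact: init_setS.
move=> h Bh; have [_ f0 eqh] := liftP _ Bh.
by exists (lift h); rewrite // -eqh; split=> //; exists h.
Qed.

(** Reducing the initial monomials of [H] to those of [G] without the action is
    enough, since applying [ract s] to such a relation gives one between the
    orbits. *)
Lemma ideal_gen_init_orbit_eq I G H :
  is_egb act le I H -> orbit_set G `<=` I ->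
  init_set H `<=` ideal_gen setT (init_set G) ->
  ideal_gen setT (init_set (orbit_set G)) = ideal_gen setT (init_set I).
Proof.
move=> [HI eqH] GI HG; have Tid := is_ideal_setT R; apply/seteqP; split.
  by apply: ideal_gen_le => //; exact: init_setS.
rewrite -eqH; apply: smallest_sub; first exact: ideal_gen_setT_is_ideal.
move=> _ [_ [[s [h Hh ->]] sh0] ->].
have h0 : h <> 0 by move=> h0; apply: sh0; rewrite h0 ract0.
rewrite initm_ract // -ract_monom.
suff /(_ _ (HG _ _)) : ideal_gen setT (init_set G) `<=`
    [set g | ideal_gen setT (init_set (orbit_set G)) (ract s g)].
  by apply; exists h.
apply: smallest_sub.
  by apply: preim_ract_is_ideal; exact: ideal_gen_setT_is_ideal.
move=> _ [g [Gg g0] ->] /=; apply: sub_gen_smallest.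
rewrite ract_monom -initm_ract //; exists (ract s g) => //.
by split; [exists s, g | exact: ract_neq0].
Qed.

(** The initial monomials of [H] are among those of the truncation, whose initial
    ideal in R_n is generated by the initial monomials of [G]. *)
Lemma groebner_gen_trunc_is_egb F n G H :
  is_egb act le (inc_ideal F) H -> H `<=` gen_trunc act F n ->
  is_groebner act le n (gen_trunc act F n) G ->
  is_egb act le (inc_ideal F) G.
Proof.
move=> Hegb HF [GF eqG].
have GI : G `<=` inc_ideal F.
  by apply: subset_trans GF _; exact: gen_trunc_sub_inc_ideal.
split=> //; apply: ideal_gen_init_orbit_eq Hegb _ _.
  exact: orbit_set_sub_inc_ideal.
have Gn : init_set G `<=` trunc n.
  by apply: init_set_trunc; apply: subset_trans GF _; exact: subIsetr.
apply: subset_trans (ideal_gen_extension (trunc_is_ideal n) Gn).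
rewrite eqG; apply: subset_trans (@sub_gen_smallest _ _ _).
exact: init_setS.
Qed.

(** * The procedure *)

Lemma egb_step_halts F H N st st' :
  is_egb act le (inc_ideal F) H -> H `<=` gen_trunc act F N ->
  (N <= st.2)%N -> egb_step act le F st st' -> egb_halts act le F st'.
Proof.
move=> Hegb HN leN [_ _ grob _].
apply: groebner_gen_trunc_is_egb Hegb _ grob.
exact: subset_trans (gen_trunc_le leN).
Qed.

Lemma egb_step_exists F st :
  noetherian (trunc st.2) -> ~ egb_halts act le F st ->
  exists st', egb_step act le F st st'.
Proof.
move=> noeth nhalts.
have [|G [finG grob]] := finite_groebner_exists noeth (J := gen_trunc act F st.2).
  exact: subIsetr.
by exists (G, st.2.+1).
Qed.

(** Each pass increases [n] by one, so the distance [N - n] bounds the number of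
    passes up to the one that starts with [n >= N]; that pass is the last by
    [egb_step_halts]. *)
Lemma egb_terminates_of_bound F H N st :
  (forall n, noetherian (trunc n)) ->
  is_egb act le (inc_ideal F) H -> H `<=` gen_trunc act F N ->
  egb_terminates act le F st.
Proof.
move=> noeth Hegb HN.
move: {-1}(N - st.2)%N (leqnn (N - st.2)) => d.
elim: d st => [|d IHd] st led;
  (have [|nhalts] := pselect (egb_halts act le F st); first exact: EgbHalt);
  apply: EgbLoop (egb_step_exists (noeth _) nhalts) _ => st' step.
- apply: EgbHalt; apply: egb_step_halts Hegb HN _ step.
  by rewrite -subn_eq0 -leqn0.
- by apply: IHd; case: step => _ _ _ ->; rewrite subnS -subn1 leq_subLR add1n.
Qed.

Lemma egb_returns_correct F st G :
  egb_returns act le F st G -> finite_set st.1 ->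
  finite_set G /\ is_egb act le (inc_ideal F) G.
Proof.
by elim=> [{}st halts //|{}st st' {}G [_ fin_st' _ _] _ IH _]; exact: IH.
Qed.

End Order.

End Action.

Theorem mainTheorem2 (K : fieldType) (M : conomType) (act : inc_action M)
    (le : rel M) (F : set {malg K[M]})
    (le_monomial : monomial_order le)
    (le_respecting : inc_respecting act le)
    (finite_width : finite_width_property K act)
    (finite_spairs : finite_spair_condition K act le)
    (trunc_noetherian : forall n : nat, noetherian (trunc K act n))
    (F_finite : finite_set F)
    (has_finite_egb : exists G : set {malg K[M]},
       finite_set G /\ is_egb act le (inc_ideal act F) G) :
  exists n0 : nat,
    width_set act F = Some n0 /\
    egb_terminates act le F (F, n0) /\
    forall G : set {malg K[M]},
      egb_returns act le F (F, n0) G ->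
      finite_set G /\ is_egb act le (inc_ideal act F) G.
Proof.
have [n0 widthF] := width_set_finite finite_width F_finite.
exists n0; split=> //; split=> [|G ret].
  have [H [finH Hegb]] := has_finite_egb.
  have [N HN] := finite_set_gen_trunc finite_width finH (proj1 Hegb).
  exact: egb_terminates_of_bound Hegb HN.
exact: egb_returns_correct ret F_finite.
Qed.
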